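(* Let $\mathbb{I}=[0,1]$ and let $d>1$ be an integer. Suppose $f\colon \mathbb{I}^{d-1}\times\mathbb{I}\to[0,\infty)$ is continuous. Then for every $\epsilon>0$ there exist a number of knots $K$ and an un-normalized SPICE model $\hat f\colon \mathbb{I}^{d-1}\times\mathbb{I}\to[0,\infty)$ (i.e. a SPICE model in which the final division by the integral is omitted), whose encoder is a single-hidden-layer feed-forward neural network, such that $$\sup_{(x,y)\in\mathbb{I}^d}\,|f(x,y)-\hat f(x,y)|<\epsilon .$$
   Context: A SPICE model of degree $n\ge 1$ with $K$ knots is defined as follows. A neural network (encoder followed by output layers) maps an input $x\in\mathbb{I}^{d-1}$ to spline parameters: sorted knot positions $0=t_1\le t_2\le\dots\le t_K=1$ and heights. On each interval $[t_i,t_{i+1}]$ one takes the $n+1$ evenly spaced points $\tau_i^j=t_i+(j-1)\frac{t_{i+1}-t_i}{n}$, $j=1,\dots,n+1$, and heights $h_i^1,\dots,h_i^{n+1}$, where consecutive pieces share endpoint heights ($h_i^{n+1}=h_{i+1}^1$), endpoint heights $h_i^1,h_i^{n+1}$ are constrained to be positive, and intermediate heights may be any real numbers (so there are $n(K-1)+1$ heights in total). Let $p_i$ be the unique polynomial of degree at most $n$ interpolating $\{(\tau_i^j,h_i^j)\}_{j=1}^{n+1}$, and let $\bar p_i(y)=\max(p_i(y),0)$. The un-normalized SPICE model is $\hat f(x,y)=\bar p_\ell(y)$ where $\ell$ is chosen so that $t_\ell\le y<t_{\ell+1}$ (with the last piece used at $y=1$), the knot positions and heights being the network's outputs at $x$.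 The (normalized) SPICE conditional density is $\hat f_\theta(y\mid x)=\bar p_\ell(y)\big/\sum_{i=1}^{K-1}\int_{t_i}^{t_{i+1}}\bar p_i(y')\,dy'$. The knot positions may be produced, e.g., by applying a softmax to network outputs to obtain positive widths summing to one and taking cumulative sums; heights at knots are made positive by a softplus. *)

(* Defs.v *)
From HB Require Import structures.
From mathcomp Require Import all_boot all_order all_algebra.
From mathcomp Require Import all_classical all_reals all_analysis.
Set Implicit Arguments. Unset Strict Implicit. Unset Printing Implicit Defensive.
Import Order.TTheory GRing.Theory Num.Theory.
Local Open Scope ring_scope.

Section SPICE.
Variable R : realType.

Definition softplus (z : R) : R := ln (1 + expR z).

Definition is_poly_fun (s : R -> R) : Prop :=
  exists q : {poly R}, forall t, s t = q.[t].

(* Parameters of a SPICE network: a single-hidden-layer encoder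
   (input dim din, hidden width m, output dim pp) followed by affine output
   layers.  Output-layer weights are indexed by nat; only the indices below
   the number of knots / pieces / degree are ever used. *)
Record spice_params (din m pp : nat) := SpiceParams {
  enc_W1 : 'I_m -> 'I_din -> R;  enc_b1 : 'I_m -> R;
  enc_W2 : 'I_pp -> 'I_m -> R;   enc_b2 : 'I_pp -> R;
  (* logits of the K-1 interval widths *)
  out_Ww : nat -> 'I_pp -> R;    out_bw : nat -> R;
  (* pre-activations of the K knot heights *)
  out_Wh : nat -> 'I_pp -> R;    out_bh : nat -> R;
  (* intermediate heights: piece i, node j (1 <= j <= n-1) *)
  out_Wg : nat -> nat -> 'I_pp -> R; out_bg : nat -> nat -> R }.

Variables (din m pp : nat) (sigma : R -> R) (K n : nat)
          (N : spice_params din m pp) (x : 'I_din -> R).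

Definition encode : 'I_pp -> R := fun k =>
  \sum_(j < m) enc_W2 N k j *
     sigma (\sum_(i < din) enc_W1 N j i * x i + enc_b1 N j) + enc_b2 N k.

Definition width_logit (i : nat) : R :=
  \sum_(k < pp) out_Ww N i k * encode k + out_bw N i.

Definition width (i : nat) : R :=
  expR (width_logit i) / \sum_(k < K.-1) expR (width_logit k).

(* knots t_0 = 0 <= ... <= t_{K-1} = 1 (0-indexed), cumulative sums *)
Definition knot (i : nat) : R := \sum_(k < i) width k.

Definition knot_height (i : nat) : R :=
  softplus (\sum_(k < pp) out_Wh N i k * encode k + out_bh N i).

Definition inter_height (i j : nat) : R :=
  \sum_(k < pp) out_Wg N i j k * encode k + out_bg N i j.

(* heights h_i^j, j = 0..n, on piece i; endpoints shared between pieces *)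
Definition height (i j : nat) : R :=
  if j == 0%N then knot_height i
  else if j == n then knot_height i.+1
  else inter_height i j.

Definition node (i j : nat) : R :=
  knot i + j%:R * (knot i.+1 - knot i) / n%:R.

Definition piece (i : nat) (y : R) : R :=
  \sum_(j < n.+1) height i j *
    \prod_(k < n.+1 | k != j) ((y - node i k) / (node i j - node i k)).

(* index l of the piece with t_l <= y < t_{l+1} (last piece at y = 1) *)
Definition piece_index (y : R) : nat :=
  count (fun i => knot i <= y) (iota 1 (K - 2)).

Definition spice_hat (y : R) : R := Num.max (piece (piece_index y) y) 0.

End SPICE.

Definition in_unit {R : realType} (y : R) : Prop := 0 <= y <= 1.
Definition in_cube {R : realType} {k : nat} (x : 'I_k -> R) : Prop :=
  forall i, in_unit (x i).

(* continuity of f on I^{k} x I (product topology, written out with max-norm) *)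
Definition cont_on_cube {R : realType} {k : nat}
  (f : ('I_k -> R) -> R -> R) : Prop :=
  forall x y, in_cube x -> in_unit y ->
  forall e : R, 0 < e -> exists2 delta : R, 0 < delta &
    forall x' y', in_cube x' -> in_unit y' ->
      (forall i, `|x' i - x i| < delta) -> `|y' - y| < delta ->
      `|f x' y' - f x y| < e.

(* Main.v *)
Require Import Defs.
From HB Require Import structures.
From mathcomp Require Import all_boot all_order all_algebra.
From mathcomp Require Import all_classical all_reals all_analysis.
From mathcomp Require Import ring lra zify.
Import Order.TTheory GRing.Theory Num.Theory.
Import numFieldNormedType.Exports.
Local Open Scope ring_scope.
Set Implicit Arguments. Unset Strict Implicit. Unset Printing Implicit Defensive.

(**
Call a function on the cube approximable if it is a uniform limit of sums
[sum_j a_j sigma(w_j.x + b_j)].  If [m(x) F(w.x + b)] is approximable for all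
[w, b], then so is [m(x) x_i (F(w.x + b + h) - F(w.x + b))]: it is the limit as
[s -> 0] of [m(x) / s] times the difference of the integrals of [F] over intervals
of length [h] starting at [w.x + b + s x_i] and at [w.x + b], and these are limits
of Riemann sums.  Starting from [sigma] this shows that
[x_i1 ... x_il (D_h^l sigma)(b)] is approximable, where [D_h] is the forward
difference.  A continuous function all of whose [l]-th differences vanish is a
polynomial, so for non-polynomial [sigma] every monomial is approximable, and
Bernstein polynomials give all continuous functions.

For the spline take equally spaced knots, fine enough that [f(x, .)] is nearly
constant on each piece, and let the network approximate [f(x, .)] at the nodes (at
the knots, the softplus preimage of [f + e]).  The Lagrange basis on a piece sums to
1 and is bounded by [n ^ n] independently of the mesh, so the interpolant stays
close to [f].
*)

(** * Uniform continuity and boundedness on cubes and segments *)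

Definition cube_continuous {R : realType} {k : nat} (g : ('I_k -> R) -> R) :=
  forall x, in_cube x -> forall e : R, 0 < e -> exists2 delta : R, 0 < delta &
    forall x', in_cube x' -> (forall i, `|x' i - x i| < delta) ->
      `|g x' - g x| < e.

Section UniformContinuity.
Variable R : realType.

(** Compactness of the cube in its near-covering form: around each [v] the triangle inequality gives
    the modulus [t] for all points within [d / 2] and all [t < d / 2], so some [t > 0] serves the
    whole cube. Points are turned into row vectors, where a product of segments is compact. *)
Lemma cube_uniformly_continuous k (g : ('I_k -> R) -> R) :
  cube_continuous g -> forall e : R, 0 < e -> exists2 delta : R, 0 < delta &
    forall x x', in_cube x -> in_cube x' ->
      (forall i, `|x' i - x i| < delta) -> `|g x' - g x| < e.
Proof.
move=> cg e e0.
pose A (_ : 'I_k) : set R := `[0, 1]%classic.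
have cA : compact [set v : 'rV[R]_k | forall i, A i (v ord0 i)].
  by apply: rV_compact => i; exact: segment_compact.
have rowK (x : 'I_k -> R) : (\row_i x i) ord0 = x by apply/funext => i; rewrite mxE.
have AE (v : 'rV[R]_k) : (forall i, A i (v ord0 i)) <-> in_cube (v ord0).
  by split=> H i; have := H i; rewrite /A /= in_itv.
pose P (delta : R) (v : 'rV[R]_k) := in_cube (v ord0) ->
  forall x', in_cube x' ->
  (forall i, `|x' i - v ord0 i| < delta) -> `|g x' - g (v ord0)| < e.
have H : \forall t \near at_right (0 : R),
    ([set v : 'rV[R]_k | forall i, A i (v ord0 i)] `<=` P t)%classic.
  apply: (iffLR (compact_near_coveringP _) cA) => v /= /AE vc.
  have [d d0 Hd] := cg _ vc (e / 2) (divr_gt0 e0 (ltr0n _ 2)).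
  have d2 : 0 < d / 2 by rewrite divr_gt0.
  exists (ball v (d / 2), [set t | t < d / 2]%classic) => /=.
    by split; [exact: nbhsx_ballx | exact: nbhs_right_lt].
  move=> [w t] /= [bw td] wc x' xc' Hx'.
  have bw' i : `|w ord0 i - v ord0 i| < d / 2.
    by rewrite distrC; case: bw => _ /(_ ord0 i).
  have h1 : `|g (w ord0) - g (v ord0)| < e / 2.
    by apply: Hd => // i; apply: lt_trans (bw' i) _; lra.
  have h2 : `|g x' - g (v ord0)| < e / 2.
    apply: Hd => // i; have := bw' i; have := Hx' i.
    rewrite -[x' i - v ord0 i](subrKA (w ord0 i)) => a b.
    by apply: le_lt_trans (ler_normD _ _) _; lra.
  rewrite -[g x' - _](subrKA (g (v ord0))).
  by apply: le_lt_trans (ler_normD _ _) _; rewrite [`|g (v _) - _|]distrC; lra.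
have : \forall t \near at_right (0 : R), 0 < t /\
    ([set v : 'rV[R]_k | forall i, A i (v ord0 i)] `<=` P t)%classic.
  by apply: filterI => //; exact: nbhs_right_gt.
move=> /filter_ex [t [t0 Pt]]; exists t => // x x' xc xc' xx'.
have := Pt (\row_i x i); rewrite /P rowK => HP.
by apply: HP => //; apply/AE; rewrite rowK.
Qed.

(** Walk from the origin to [x] along the points [j / N * x]. Each of the [N] steps moves every
    coordinate by less than [d], hence changes [g] by less than 1. *)
Lemma cube_bounded k (g : ('I_k -> R) -> R) :
  cube_continuous g -> exists M : R, forall x, in_cube x -> `|g x| <= M.
Proof.
move=> cg; have [d d0 Hd] := cube_uniformly_continuous cg ltr01.
pose N := (Num.truncn d^-1).+1.
have Nd : N%:R^-1 < d.
  by rewrite invf_plt ?posrE ?ltr0n // truncnS_gt.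
have N0 : 0 < N%:R :> R by rewrite ltr0n.
exists (`|g (fun=> 0)| + N%:R) => x xc.
pose z j : 'I_k -> R := fun i => j%:R / N%:R * x i.
have zc j : (j <= N)%N -> in_cube (z j).
  move=> jN i; have /andP[x0 x1] := xc i; apply/andP; split.
    by rewrite !mulr_ge0 // invr_ge0 ltW.
  rewrite -[1](mulr1 1) ler_pM // ?mulr_ge0 ?invr_ge0 // ?(ltW N0) //.
  by rewrite ler_pdivrMr // mul1r ler_nat.
have Hj j : (j <= N)%N -> `|g (z j)| <= `|g (fun=> 0)| + j%:R.
  elim: j => [|j IH] jN.
    rewrite addr0 (_ : z 0%N = fun=> 0) //.
    by apply/funext => i; rewrite /z !mul0r.
  have := IH (ltnW jN); have : `|g (z j.+1) - g (z j)| < 1.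
    apply: Hd; [exact/zc/ltnW | exact: zc |] => i; apply: le_lt_trans Nd.
    have /andP[x0 x1] := xc i.
    rewrite /z -mulrBl -mulrBl -natrB ?subSnn ?mul1r //.
    by rewrite ger0_norm ?mulr_ge0 ?invr_ge0 ?(ltW N0) // ler_piMr ?invr_ge0 ?(ltW N0).
  move=> a b; rewrite -[g (z j.+1)](subrK (g (z j))).
  by apply: le_trans (ler_normD _ _) _; rewrite -natr1; lra.
have := Hj N (leqnn _); rewrite (_ : z N = x) //.
by apply/funext => i; rewrite /z divff ?mul1r // gt_eqF.
Qed.

(** Parametrising the segment from [- A] to [A] by a one-dimensional cube lets the two preceding
    results carry over to functions of a real variable. *)
Lemma cube_continuous_affine (F : R -> R) (A : R) : continuous F -> 0 < A ->
  cube_continuous (fun x : 'I_1 -> R => F (- A + 2 * A * x ord0)).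
Proof.
move=> cF A0 x _ e e0.
have /cvgrPdist_lt /(_ e e0) := cF (- A + 2 * A * x ord0).
case/nbhs_ballP => d /= d0 Hd; exists (d / (2 * A)); first by rewrite divr_gt0 //; lra.
move=> x' _ /(_ ord0) h; rewrite distrC; apply: Hd; rewrite /ball /= distrC.
rewrite (_ : _ - _ = (x' ord0 - x ord0) * (2 * A)); last by ring.
by rewrite normrM [`|2 * A|]gtr0_norm ?mulr_gt0 // -ltr_pdivlMr // mulr_gt0.
Qed.

Lemma segment_uniformly_continuous (F : R -> R) (A : R) : continuous F -> 0 < A ->
  forall e : R, 0 < e -> exists2 delta : R, 0 < delta &
    forall y y', `|y| <= A -> `|y'| <= A -> `|y' - y| < delta ->
      `|F y' - F y| < e.
Proof.
move=> cF A0 e e0.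
have [d d0 Hd] := cube_uniformly_continuous (cube_continuous_affine cF A0) e0.
exists (d * (2 * A)); first by rewrite !mulr_gt0.
have A2 : 0 < 2 * A by lra.
have uK y : - A + 2 * A * ((y + A) / (2 * A)) = y by field; rewrite gt_eqF.
move=> y y' yA yA' yy'.
have := Hd (fun=> (y + A) / (2 * A)) (fun=> (y' + A) / (2 * A)); rewrite !uK; apply.
- move=> _; rewrite /in_unit; move: yA; rewrite ler_norml => /andP[a b].
  by rewrite divr_ge0 ?ler_pdivrMr //; lra.
- move=> _; rewrite /in_unit; move: yA'; rewrite ler_norml => /andP[a b].
  by rewrite divr_ge0 ?ler_pdivrMr //; lra.
- move=> _; rewrite (_ : _ - _ = (y' - y) / (2 * A)); last by field; rewrite gt_eqF.
  by rewrite normrM normfV (gtr0_norm A2) ltr_pdivrMr.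
Qed.

Lemma segment_bounded (F : R -> R) (A : R) : continuous F -> 0 < A ->
  exists M : R, forall y, `|y| <= A -> `|F y| <= M.
Proof.
move=> cF A0; have [M HM] := cube_bounded (cube_continuous_affine cF A0).
exists M => y yA; have := HM (fun=> (y + A) / (2 * A)).
have A2 : 0 < 2 * A by lra.
rewrite (_ : - A + _ = y); last by field; rewrite gt_eqF.
apply=> _; rewrite /in_unit; move: yA; rewrite ler_norml => /andP[a b].
by rewrite divr_ge0 ?ler_pdivrMr //; lra.
Qed.

End UniformContinuity.

(** * Continuous functions with vanishing iterated differences *)

Section FrechetPolynomial.
Variable R : realType.

Definition fdiff (h : R) (F : R -> R) : R -> R := fun y => F (y + h) - F y.

(** By linearity monomials suffice. The difference of ['X^(j.+1)] is [j.+1 * 'X^j] plus lower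
    powers, whose antidifferences come from strong induction. *)
Lemma poly_antidifference (q : {poly R}) :
  exists p : {poly R}, forall y, p.[y + 1] - p.[y] = q.[y].
Proof.
pose has_anti (q : {poly R}) :=
  exists p : {poly R}, forall y, p.[y + 1] - p.[y] = q.[y].
have anti0 : has_anti 0 by exists 0 => y; rewrite !horner0 subrr.
have antiD q1 q2 : has_anti q1 -> has_anti q2 -> has_anti (q1 + q2).
  by move=> [p1 H1] [p2 H2]; exists (p1 + p2) => y; rewrite !hornerD -H1 -H2; ring.
have antiZ c q1 : has_anti q1 -> has_anti (c *: q1).
  by move=> [p1 H1]; exists (c *: p1) => y; rewrite !hornerZ -H1; ring.
have antiX j : has_anti 'X^j.
  elim/ltn_ind: j => j IH.
  have [p Hp] : has_anti (\sum_(i < j) 'C(j.+1, i)%:R *: 'X^i).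
    apply: (big_ind has_anti) => // i _; apply: antiZ; exact: IH.
  exists (j.+1%:R^-1 *: ('X^(j.+1) - p)) => y.
  have Hj : (y + 1) ^+ j.+1 - y ^+ j.+1 =
      j.+1%:R * y ^+ j + \sum_(i < j) 'C(j.+1, i)%:R * y ^+ i.
    rewrite [y + 1]addrC exprDn big_ord_recr /= subnn expr0 mul1r binn mulr1n.
    rewrite addrK big_ord_recr /= binSn expr1n mul1r -mulr_natl addrC.
    congr (_ + _); apply: eq_bigr => i _.
    by rewrite expr1n mul1r mulr_natl.
  have := Hp y; rewrite horner_sum.
  under eq_bigr do rewrite hornerZ hornerXn.
  move=> Hp'; rewrite !(hornerZ, hornerD, hornerN, hornerXn) -mulrBr.
  rewrite [X in _ * X](_ : _ = ((y + 1) ^+ j.+1 - y ^+ j.+1) -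
    (p.[y + 1] - p.[y])); last by ring.
  by rewrite Hj Hp' addrK mulrA mulVf ?mul1r // pnatr_eq0.
change (has_anti q); rewrite -[q]coefK poly_def.
by apply: (big_ind has_anti) => // i _; exact: antiZ.
Qed.

(** By induction the difference sequence is polynomial; [u] and an antidifference of that polynomial
    then differ by a constant, fixed at 0. *)
Lemma seq_diff_poly k (u : nat -> R) :
  (forall n, iter k (fun v n => v n.+1 - v n) u n = 0) ->
  exists p : {poly R}, forall n, u n = p.[n%:R].
Proof.
elim: k u => [|k IH] u Hu; first by exists 0 => n; rewrite horner0 -(Hu n).
have [q Hq] : exists q : {poly R}, forall n, u n.+1 - u n = q.[n%:R].
  by apply: IH => n; rewrite -(Hu n) iterSr.
have [p Hp] := poly_antidifference q.
exists (p + (u 0%N - p.[0])%:P) => n; rewrite hornerD hornerC.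
elim: n => [|n IHn]; first by rewrite addrC subrK.
by rewrite -[LHS](subrK (u n)) Hq -Hp IHn natr1; ring.
Qed.

Lemma poly_eq_nat (p q : {poly R}) :
  (forall n : nat, p.[n%:R] = q.[n%:R]) -> p = q.
Proof.
move=> H; apply/eqP; rewrite -subr_eq0; apply/eqP.
pose s := [seq n%:R : R | n <- iota 0 (size (p - q))].
apply: (@roots_geq_poly_eq0 _ _ s).
- by apply/allP => _ /mapP[n _ ->]; rewrite rootE hornerD hornerN H subrr.
- rewrite map_inj_uniq ?iota_uniq // => a b /eqP; rewrite eqr_nat => /eqP //.
- by rewrite size_map size_iota.
Qed.

Lemma iter_fdiff_seq k h (F : R -> R) b n :
  iter k (fdiff h) F (b + n%:R * h) =
  iter k (fun v n => v n.+1 - v n) (fun n => F (b + n%:R * h)) n.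
Proof.
elim: k n => //= k IH n; rewrite /fdiff -!IH.
by rewrite (_ : b + n%:R * h + h = b + n.+1%:R * h) // -natr1; ring.
Qed.

(* On every grid [- M + n / (N + 1)], [n : nat], [F] is given by a
   polynomial; all these polynomials agree at the natural numbers, hence
   coincide, and the grids are jointly dense. *)
Lemma iter_fdiff_eq0_poly k (F : R -> R) : continuous F ->
  (forall h b, 0 < h -> iter k (fdiff h) F b = 0) -> is_poly_fun F.
Proof.
move=> cF HF.
have grid b h : 0 < h -> exists p : {poly R}, forall n, F (b + n%:R * h) = p.[n%:R].
  by move=> h0; apply: (@seq_diff_poly k) => n; rewrite -iter_fdiff_seq HF.
have [q Hq] := grid 0 1 ltr01.
have {}Hq n : F n%:R = q.[n%:R] by rewrite -Hq add0r mulr1.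
have Fq M N n : F (- M%:R + n%:R * N.+1%:R^-1) = q.[- M%:R + n%:R * N.+1%:R^-1].
  have [p Hp] := grid (- M%:R) N.+1%:R^-1 (ltac:(by rewrite invr_gt0 ltr0n)).
  rewrite Hp.
  have N0 : N.+1%:R != 0 :> R by rewrite pnatr_eq0.
  (* The natural number [j] is the grid point of index [(N + 1)(j + M)], so after this rescaling [p]
     takes the values of [F] at all natural numbers. *)
  have E : p \Po ((N.+1%:R)%:P * ('X + M%:R%:P)) = q.
    apply: poly_eq_nat => j; rewrite horner_comp !hornerE.
    rewrite -natrD -natrM -Hp -Hq natrM natrD; congr F; field.
    by rewrite addrC natr1.
  rewrite -E horner_comp !hornerE; congr horner; field.
  by rewrite addrC natr1.
exists q => y.
apply/eqP; rewrite -subr_eq0; apply/negP => /negP ne0.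
pose G t := F t - q.[t].
have cG : {for y, continuous G}.
  apply: cvgB; [exact: cF | exact: continuous_horner].
have /cvgrPdist_lt /(_ `|G y|) := cG.
rewrite normr_gt0 => /(_ ne0) /nbhs_ballP [d /= d0 Hd].
pose N := Num.truncn d^-1; pose M := (Num.truncn `|y|).+1.
have yM : 0 <= y + M%:R.
  have := truncnS_gt `|y|; rewrite -/M => a.
  have : - y <= `|y| by rewrite -normrN ler_norm.
  by lra.
have N0 : 0 < N.+1%:R :> R by rewrite ltr0n.
(* The grid point of index [n] is the last one not exceeding [y], so it is within [1 / (N + 1) < d]
   of [y]. Since [G] vanishes there, continuity would give [|G y| < |G y|]. *)
pose n := Num.truncn ((y + M%:R) * N.+1%:R).
have /andP[n1 n2] : n%:R <= (y + M%:R) * N.+1%:R < n.+1%:R.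
  by apply: truncn_itv; rewrite mulr_ge0 // ltW.
have Nd : N.+1%:R^-1 < d by rewrite invf_plt ?posrE // truncnS_gt.
have := Hd (- M%:R + n%:R * N.+1%:R^-1); rewrite /G Fq subrr subr0 ltxx.
move=> H; suff /H : ball y d (- M%:R + n%:R * N.+1%:R^-1) by [].
rewrite /ball /= (_ : y - _ = ((y + M%:R) * N.+1%:R - n%:R) / N.+1%:R); last first.
  by field; rewrite addrC natr1 gt_eqF.
rewrite ger0_norm; last by rewrite divr_ge0 ?(ltW N0) // subr_ge0.
apply: le_lt_trans Nd; rewrite ler_pdivrMr // mulVf ?gt_eqF //.
by move: n2; rewrite -natr1; lra.
Qed.

End FrechetPolynomial.

(** * Riemann sums for the directional difference *)

Section DirectionalDifference.
Variable R : realType.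

(* Discrete form of
   [\int_(y+u)^(y+u+h) F - \int_y^(y+h) F = \int_(y+h)^(y+h+u) F - \int_y^(y+u) F]:
   up to rounding [u] to a multiple [q r] of the mesh, both sides telescope. *)
Lemma riemann_shift_estimate (F : R -> R) (A M s r wr ws h y u : R) (N : nat) :
  0 < r -> h = N%:R * r -> 0 <= u <= s -> `|y| + h + s <= A ->
  (forall a, `|a| <= A -> `|F a| <= M) ->
  (forall a a', `|a| <= A -> `|a'| <= A -> `|a' - a| <= r -> `|F a' - F a| <= wr) ->
  (forall a a', `|a| <= A -> `|a'| <= A -> `|a' - a| <= s -> `|F a' - F a| <= ws) ->
  `|r * (\sum_(j < N) F (y + u + j%:R * r) - \sum_(j < N) F (y + j%:R * r))
    - u * fdiff h F y| <= h * wr + 2 * s * ws + 2 * M * r.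
Proof.
move=> r0 hN /andP[u0 us] yA HM Hr Hs.
have h0 : 0 <= h by rewrite hN mulr_ge0 // ltW.
have Ay t : 0 <= t <= h + s -> `|y + t| <= A.
  move=> /andP[t0 ts]; apply: le_trans (ler_normD _ _) _.
  by rewrite (ger0_norm t0); lra.
pose q := Num.truncn (u / r).
have /andP[q1 q2] : q%:R <= u / r < q.+1%:R.
  by apply: truncn_itv; rewrite divr_ge0 // ltW.
move: q1 q2; rewrite ler_pdivlMr // ltr_pdivrMr // -natr1 mulrDl mul1r => q1 q2.
have q0 : 0 <= q%:R * r by rewrite mulr_ge0 // ltW.
have jN (j : nat) (n : nat) : (j <= n)%N -> 0 <= j%:R * r <= n%:R * r.
  by move=> jn; rewrite mulr_ge0 ?ler_wpM2r ?ler_nat // ltW.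
have E1 : `|r * (\sum_(j < N) F (y + u + j%:R * r)
                - \sum_(j < N) F (y + (q + j)%:R * r))| <= h * wr.
  rewrite -sumrB normrM (gtr0_norm r0) mulrC hN -mulrA [r * wr]mulrC mulrA.
  rewrite ler_wpM2r ?(ltW r0) //; apply: le_trans (ler_norm_sum _ _ _) _.
  rewrite -[N in N%:R * _]card_ord mulr_natl -sumr_const; apply: ler_sum => j _.
  have /andP[j1 j2] := jN _ _ (ltnW (ltn_ord j)).
  apply: Hr.
  - by apply: Ay; rewrite natrD mulrDl; lra.
  - by rewrite -addrA; apply: Ay; lra.
  - rewrite natrD mulrDl (_ : _ - _ = u - q%:R * r); last by ring.
    by rewrite ger0_norm; lra.
(* The sum over [q + N] consecutive grid points is split in two ways: after the first [q] terms, and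
   after the first [N]. *)
have tele : \sum_(j < N) F (y + (q + j)%:R * r) - \sum_(j < N) F (y + j%:R * r)
    = \sum_(j < q) (F (y + (N + j)%:R * r) - F (y + j%:R * r)).
  pose a j := F (y + j%:R * r).
  have e1 : \sum_(j < q + N) a j = \sum_(j < q) a j + \sum_(j < N) a (q + j)%N.
    by rewrite big_split_ord.
  have e2 : \sum_(j < q + N) a j = \sum_(j < N) a j + \sum_(j < q) a (N + j)%N.
    by rewrite addnC big_split_ord.
  by rewrite sumrB; move: e1; rewrite e2 /a => e1; lra.
(* As [N * r = h], each term is [fdiff h F] at a point within [s] of [y], and replacing it by the
   value at [y] costs at most [2 * ws]. There are [q] terms, and [q * r <= s]. *)
have E2 : `|r * \sum_(j < q) (F (y + (N + j)%:R * r) - F (y + j%:R * r))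
            - q%:R * r * fdiff h F y| <= 2 * s * ws.
  have ws0 : 0 <= ws.
    have A0 : `|y + 0| <= A by apply: Ay; lra.
    by apply: le_trans (Hs _ _ A0 A0 _); rewrite // subrr normr0; lra.
  rewrite (_ : _ - _ = r * \sum_(j < q) (F (y + (N + j)%:R * r) - F (y + j%:R * r)
      - fdiff h F y)); last first.
    by rewrite [X in _ = r * X]sumrB sumr_const card_ord -mulr_natl; ring.
  rewrite normrM (gtr0_norm r0).
  apply: (@le_trans _ _ (r * (q%:R * (2 * ws)))); last first.
    rewrite (_ : _ * _ = q%:R * r * (2 * ws)); last by ring.
    by rewrite (_ : 2 * s * ws = s * (2 * ws)); [apply: ler_wpM2r; lra | ring].
  rewrite ler_wpM2l ?(ltW r0) //; apply: le_trans (ler_norm_sum _ _ _) _.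
  rewrite -[q in q%:R * _]card_ord mulr_natl -sumr_const; apply: ler_sum => j _.
  have /andP[j1 j2] := jN _ _ (ltnW (ltn_ord j)).
  rewrite /fdiff natrD mulrDl -hN.
  rewrite (_ : _ - _ = (F (y + (h + j%:R * r)) - F (y + h)) -
                       (F (y + j%:R * r) - F y)); last by ring.
  apply: le_trans (ler_normB _ _) _; rewrite mulrDl mul1r; apply: lerD; apply: Hs.
  - by apply: Ay; lra.
  - by apply: Ay; lra.
  - by rewrite (_ : _ - _ = j%:R * r); [rewrite ger0_norm; lra | ring].
  - by rewrite -[y]addr0; apply: Ay; lra.
  - by apply: Ay; lra.
  - by rewrite (_ : _ - _ = j%:R * r); [rewrite ger0_norm; lra | ring].
have E3 : `|(u - q%:R * r) * fdiff h F y| <= 2 * M * r.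
  have Fy : `|fdiff h F y| <= 2 * M.
    apply: le_trans (ler_normB _ _) _; rewrite mulrDl mul1r; apply: lerD; apply: HM.
      by apply: Ay; lra.
    by rewrite -[y]addr0; apply: Ay; lra.
  rewrite normrM mulrC ler_pM //; rewrite ger0_norm; lra.
set T1 := \sum_(j < N) F (y + u + _) in E1 *.
set T2 := \sum_(j < N) F (y + (q + j)%:R * r) in E1 tele.
set T3 := \sum_(j < N) F (y + _) in tele *.
rewrite -tele in E2.
rewrite (_ : _ - _ = r * (T1 - T2) + (r * (T2 - T3) - q%:R * r * fdiff h F y)
   - (u - q%:R * r) * fdiff h F y); last by ring.
apply: le_trans (ler_normB _ _) _; apply: lerD => //.
by apply: le_trans (ler_normD _ _) _; apply: lerD.
Qed.

End DirectionalDifference.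

(** * Bernstein approximation on the cube *)

Section Bernstein.
Variable R : realType.
Implicit Types (t : R) (n j : nat).

(* The distribution of a sum of [n] Bernoulli([t]) variables, built one
   variable at a time. *)
Fixpoint bernstein n j t : R :=
  if n is n'.+1 then
    (if j is j'.+1 then t * bernstein n' j' t else 0) + (1 - t) * bernstein n' j t
  else (j == 0%N)%:R.

Lemma bernstein_ge0 n j t : in_unit t -> 0 <= bernstein n j t.
Proof.
move=> /andP[t0 t1]; elim: n j => [|n IH] j /=; first by rewrite ler0n.
by case: j => [|j]; rewrite ?add0r ?addr_ge0 // mulr_ge0 // subr_ge0.
Qed.

Lemma bernstein_gt n j t : (n < j)%N -> bernstein n j t = 0.
Proof.
elim: n j => [|n IH] [|j] //= nj; rewrite !IH ?mulr0 ?addr0 //.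
exact: ltn_trans nj.
Qed.

(** Conditioning on the last trial, which raises the count with probability [t]. All moments below
    follow from this by induction on [n]. *)
Lemma bernstein_sumS n (phi : nat -> R) t :
  \sum_(j < n.+2) phi j * bernstein n.+1 j t =
  t * (\sum_(j < n.+1) phi j.+1 * bernstein n j t) +
  (1 - t) * (\sum_(j < n.+1) phi j * bernstein n j t).
Proof.
have -> : (1 - t) * (\sum_(j < n.+1) phi j * bernstein n j t) =
    (1 - t) * (\sum_(j < n.+2) phi j * bernstein n j t).
  by rewrite [in RHS]big_ord_recr /= bernstein_gt // mulr0 addr0.
rewrite !(big_ord_recl n.+1) /= add0r mulrDr addrCA !mulr_sumr; congr (_ + _).
  by ring.
by rewrite -big_split; apply: eq_bigr => j _ /=; rewrite /bump leq0n add1n; ring.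
Qed.

Lemma bernstein_moment0 n t : \sum_(j < n.+1) bernstein n j t = 1.
Proof.
rewrite (eq_bigr (fun j : 'I_n.+1 => 1 * bernstein n j t)) => [|j _]; last first.
  by rewrite mul1r.
elim: n => [|n IH]; first by rewrite big_ord1 mul1r.
by rewrite (bernstein_sumS _ (fun=> 1)) IH; ring.
Qed.

Lemma bernstein_moment1 n t :
  \sum_(j < n.+1) (j%:R - n%:R * t) * bernstein n j t = 0.
Proof.
elim: n => [|n IH]; first by rewrite big_ord1 mul0r subrr mul0r.
rewrite (bernstein_sumS _ (fun j => j%:R - n.+1%:R * t)).
rewrite (eq_bigr (fun j : 'I_n.+1 => (j%:R - n%:R * t) * bernstein n j t +
  (1 - t) * bernstein n j t)) => [|j _]; last by rewrite -!natr1; ring.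
rewrite [X in _ + _ * X](eq_bigr (fun j : 'I_n.+1 => (j%:R - n%:R * t) * bernstein n j t +
  (- t) * bernstein n j t)) => [|j _]; last by rewrite -!natr1; ring.
by rewrite !big_split /= -!mulr_sumr IH bernstein_moment0; ring.
Qed.

Lemma bernstein_moment2 n t :
  \sum_(j < n.+1) (j%:R - n%:R * t) ^+ 2 * bernstein n j t = n%:R * t * (1 - t).
Proof.
elim: n => [|n IH]; first by rewrite big_ord1 !mul0r subrr expr0n mul0r.
rewrite (bernstein_sumS _ (fun j => (j%:R - n.+1%:R * t) ^+ 2)).
rewrite (eq_bigr (fun j : 'I_n.+1 => (j%:R - n%:R * t) ^+ 2 * bernstein n j t +
  2 * (1 - t) * ((j%:R - n%:R * t) * bernstein n j t) +
  (1 - t) ^+ 2 * bernstein n j t)) => [|j _]; last by rewrite -!natr1; ring.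
rewrite [X in _ + _ * X](eq_bigr (fun j : 'I_n.+1 =>
  (j%:R - n%:R * t) ^+ 2 * bernstein n j t +
  (- 2 * t) * ((j%:R - n%:R * t) * bernstein n j t) +
  t ^+ 2 * bernstein n j t)) => [|j _]; last by rewrite -!natr1; ring.
rewrite !big_split /= -!mulr_sumr IH bernstein_moment0 bernstein_moment1.
by rewrite -natr1; ring.
Qed.

Lemma bernstein_variance_le n t : (0 < n)%N -> in_unit t ->
  \sum_(j < n.+1) (t - j%:R / n%:R) ^+ 2 * bernstein n j t <= n%:R^-1.
Proof.
move=> n0 /andP[t0 t1]; have nR : 0 < n%:R :> R by rewrite ltr0n.
have nR0 : n%:R != 0 :> R by rewrite gt_eqF.
rewrite (eq_bigr (fun j : 'I_n.+1 =>
    n%:R ^- 2 * ((j%:R - n%:R * t) ^+ 2 * bernstein n j t))); last first.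
  by move=> j _; field.
rewrite -mulr_sumr bernstein_moment2.
rewrite (_ : _ * _ = n%:R^-1 * (t * (1 - t))); last by field.
by rewrite ler_piMr ?invr_ge0 ?(ltW nR) //; nra.
Qed.

Section Multivariate.
Variables (k n : nat).
Implicit Types (nu : {ffun 'I_k -> 'I_n.+1}) (x : 'I_k -> R).

Definition mbernstein nu x : R := \prod_i bernstein n (nu i) (x i).

Definition grid_point nu : 'I_k -> R := fun i => (nu i)%:R / n%:R.

Lemma mbernstein_ge0 nu x : in_cube x -> 0 <= mbernstein nu x.
Proof. by move=> xc; apply: prodr_ge0 => i _; exact: bernstein_ge0. Qed.

Lemma grid_point_cube nu : (0 < n)%N -> in_cube (grid_point nu).
Proof.
move=> n0 i; rewrite /in_unit /grid_point divr_ge0 // ler_pdivrMr ?ltr0n //.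
by rewrite mul1r ler_nat -ltnS ltn_ord.
Qed.

Lemma mbernstein_sum x : \sum_nu mbernstein nu x = 1.
Proof.
rewrite /mbernstein -(bigA_distr_bigA (fun i (j : 'I_n.+1) => bernstein n j (x i))).
by apply: big1 => i _; rewrite bernstein_moment0.
Qed.

(** With the square placed in the factor of coordinate [i] alone, the sum over the grid becomes a
    product of one-variable sums. All of them equal 1 except the [i]-th, which is a one-dimensional
    variance. *)
Lemma mbernstein_variance_le i x : (0 < n)%N -> in_cube x ->
  \sum_nu (x i - grid_point nu i) ^+ 2 * mbernstein nu x <= n%:R^-1.
Proof.
move=> n0 xc.
pose G i' (j : 'I_n.+1) := (if i' == i then (x i - j%:R / n%:R) ^+ 2 else 1)
  * bernstein n j (x i').
rewrite (eq_bigr (fun nu => \prod_i' G i' (nu i'))); last first.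
  move=> nu _; rewrite /G big_split /= -/(mbernstein nu x); congr (_ * _).
  by rewrite (bigD1 i) //= eqxx big1 ?mulr1 // => i' /negPf ->.
rewrite -bigA_distr_bigA (bigD1 i) //= [X in _ * X]big1 => [|i' ii'].
  rewrite mulr1 /G eqxx; exact: bernstein_variance_le.
rewrite /G (negPf ii') -[RHS](bernstein_moment0 n (x i')).
by apply: eq_bigr => j _; rewrite mul1r.
Qed.

End Multivariate.

(** Chebyshev's argument: uniform continuity handles grid points near [x], and the variance pays for
    the far ones. *)
Lemma mbernstein_dense k (g : ('I_k -> R) -> R) (e : R) : cube_continuous g -> 0 < e ->
  exists n, forall x, in_cube x ->
    `|g x - \sum_(nu : {ffun 'I_k -> 'I_n.+1}) g (grid_point nu) * mbernstein nu x| <= e.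
Proof.
move=> cg e0; have e2 : 0 < e / 2 by rewrite divr_gt0.
have [M HM] := cube_bounded cg.
have M0 : 0 <= M by apply: le_trans (HM (fun=> 0) _) => // i; rewrite /in_unit lexx ler01.
have [d d0 Hd] := cube_uniformly_continuous cg e2.
(* If some coordinate differs by at least [d], then [c] times the squared distance is at least
   [2 * M], the trivial bound on the change of [g]. *)
pose c := 2 * M / d ^+ 2.
have dd : 0 < d ^+ 2 by rewrite exprn_gt0.
have c0 : 0 <= c by rewrite divr_ge0 ?mulr_ge0 // ltW.
pose n := (Num.truncn (c * k%:R / (e / 2))).+1.
have nR : 0 < n%:R :> R by rewrite ltr0n.
have nb : c * k%:R * n%:R^-1 <= e / 2.
  rewrite ler_pdivrMr // [e / 2 * _]mulrC -ler_pdivrMr //; exact/ltW/truncnS_gt.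
exists n => x xc.
have key z : in_cube z -> `|g x - g z| <= e / 2 + c * \sum_i (x i - z i) ^+ 2.
  move=> zc.
  have S0 : 0 <= \sum_i (x i - z i) ^+ 2 by apply: sumr_ge0 => i _; exact: sqr_ge0.
  have [near|/existsNP[i /negP]] := pselect (forall i, `|x i - z i| < d).
    by apply: le_trans (ltW (Hd _ _ zc xc near)) _; rewrite lerDl mulr_ge0.
  rewrite -leNgt => far.
  apply: le_trans (ler_normB _ _) _.
  apply: le_trans (lerD (HM _ xc) (HM _ zc)) _.
  apply: (@le_trans _ _ (c * d ^+ 2)); first by rewrite /c divfK ?gt_eqF //; lra.
  apply: le_trans (_ : c * \sum_i (x i - z i) ^+ 2 <= _); last by rewrite lerDr ltW.
  apply: ler_wpM2l => //; rewrite (bigD1 i) //= -[(x i - z i) ^+ 2]real_normK ?num_real //.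
  apply: le_trans (_ : `|x i - z i| ^+ 2 <= _).
    by rewrite lerXn2r // nnegrE // ltW.
  by rewrite lerDl; apply: sumr_ge0 => j _; exact: sqr_ge0.
rewrite -[g x]mulr1 -[X in g x * X](mbernstein_sum n x) mulr_sumr -sumrB.
apply: le_trans (ler_norm_sum _ _ _) _.
apply: (@le_trans _ _ (\sum_(nu : {ffun 'I_k -> 'I_n.+1})
   (e / 2 * mbernstein nu x +
    c * \sum_i (x i - grid_point nu i) ^+ 2 * mbernstein nu x))).
  apply: ler_sum => nu _; rewrite -mulrBl normrM.
  rewrite [`|mbernstein _ _|]ger0_norm ?mbernstein_ge0 //.
  rewrite -mulr_suml mulrA -mulrDl ler_wpM2r ?mbernstein_ge0 //.
  by apply: key; exact: grid_point_cube.
rewrite big_split /= -!mulr_sumr mbernstein_sum mulr1 exchange_big /=.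
apply: (@le_trans _ _ (e / 2 + c * \sum_(i < k) n%:R^-1)).
  rewrite lerD2l ler_wpM2l //; apply: ler_sum => i _.
  exact: mbernstein_variance_le.
by rewrite sumr_const card_ord -[_ *+ k]mulr_natl mulrA; lra.
Qed.

End Bernstein.

(** * Universal approximation by one hidden layer *)

Section UniversalApproximation.
Variables (R : realType) (sigma : R -> R) (k : nat).
Implicit Types (w x : 'I_k -> R) (g m : ('I_k -> R) -> R).

Definition dot w x : R := \sum_(i < k) w i * x i.

(** Each unit is a triple of output weight, input weights and bias. Keeping units in a list makes
    the sum of two networks a concatenation. *)
Definition shallow_net (s : seq (R * ('I_k -> R) * R)) x : R :=
  \sum_(u <- s) u.1.1 * sigma (dot u.1.2 x + u.2).

Definition approximable g := forall e : R, 0 < e ->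
  exists s, forall x, in_cube x -> `|g x - shallow_net s x| <= e.

Lemma approximable_ext g g' : (forall x, in_cube x -> g x = g' x) ->
  approximable g -> approximable g'.
Proof.
by move=> gg' + e e0 => /(_ e e0) [s Hs]; exists s => x xc; rewrite -gg' //; exact: Hs.
Qed.

Lemma approximable_limit g : (forall e : R, 0 < e -> exists2 g', approximable g' &
  forall x, in_cube x -> `|g x - g' x| <= e) -> approximable g.
Proof.
move=> H e e0; have e2 : 0 < e / 2 by rewrite divr_gt0.
have [g' /(_ _ e2) [s Hs] Hg'] := H _ e2.
exists s => x xc; have := Hs x xc; have := Hg' x xc.
rewrite -[g x - shallow_net _ _](subrKA (g' x)) => a b.
by apply: le_trans (ler_normD _ _) _; lra.
Qed.

Lemma approximable0 : approximable (fun=> 0).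
Proof.
by move=> e e0; exists [::] => x _; rewrite /shallow_net big_nil subrr normr0 ltW.
Qed.

Lemma approximableD g1 g2 : approximable g1 -> approximable g2 ->
  approximable (fun x => g1 x + g2 x).
Proof.
move=> H1 H2 e e0; have e2 : 0 < e / 2 by rewrite divr_gt0.
have [[s1 Hs1] [s2 Hs2]] := (H1 _ e2, H2 _ e2).
exists (s1 ++ s2) => x xc; rewrite /shallow_net big_cat /= opprD addrACA.
apply: le_trans (ler_normD _ _) _.
by have := Hs1 x xc; have := Hs2 x xc; rewrite /shallow_net; lra.
Qed.

Lemma approximableZ c g : approximable g -> approximable (fun x => c * g x).
Proof.
move=> H e e0; have c0 : 0 < `|c| + 1 by rewrite ltr_wpDl.
have [s Hs] := H _ (divr_gt0 e0 c0).
exists [seq (c * u.1.1, u.1.2, u.2) | u <- s] => x xc.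
rewrite /shallow_net big_map /=; under eq_bigr do rewrite -mulrA.
rewrite -mulr_sumr -mulrBr normrM; have := Hs x xc; rewrite ler_pdivlMr //.
rewrite -/(shallow_net s x) => a.
by apply: le_trans a; rewrite mulrC ler_wpM2l //; lra.
Qed.

Lemma approximable_sum (I : Type) (r : seq I) (G : I -> ('I_k -> R) -> R) :
  (forall i, approximable (G i)) -> approximable (fun x => \sum_(i <- r) G i x).
Proof.
move=> HG; elim: r => [|i r IH].
  by apply: approximable_ext approximable0 => x _; rewrite big_nil.
by apply: approximable_ext (approximableD (HG i) IH) => x _; rewrite big_cons.
Qed.

Lemma approximable_unit w b : approximable (fun x => sigma (dot w x + b)).
Proof.
move=> e e0; exists [:: (1, w, b)] => x _.
by rewrite /shallow_net big_seq1 mul1r subrr normr0 ltW.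
Qed.

Lemma norm_dot_le w x : in_cube x -> `|dot w x| <= \sum_(i < k) `|w i|.
Proof.
move=> xc; apply: le_trans (ler_norm_sum _ _ _) _; apply: ler_sum => i _.
by have /andP[x0 x1] := xc i; rewrite normrM (ger0_norm x0) ler_piMr.
Qed.

(** The factor [m] is carried along so that the step can be iterated: each use gains one coordinate
    and one difference. *)
Lemma approximable_fdiff (F : R -> R) m (i : 'I_k) (h : R) :
  continuous F -> 0 < h -> (forall x, in_cube x -> `|m x| <= 1) ->
  (forall w b, approximable (fun x => m x * F (dot w x + b))) ->
  forall w b, approximable (fun x => m x * x i * fdiff h F (dot w x + b)).
Proof.
move=> cF h0 m1 HmF w b; apply: approximable_limit => e e0.
pose Y := \sum_(i < k) `|w i| + `|b|.
have Y0 : 0 <= Y by rewrite addr_ge0 // sumr_ge0.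
pose A := Y + h + 1; have A0 : 0 < A by rewrite /A; lra.
have [M HM] := segment_bounded cF A0.
have M0 : 0 <= M by apply: le_trans (HM 0 _); rewrite // normr0 ltW.
(* The tolerances chosen from here on make each of the three terms of [riemann_shift_estimate] at
   most [e * s / 4], so their sum divided by [s] stays below [e]. *)
have e8 : 0 < e / 8 by rewrite divr_gt0.
have [d d0 Hd] := segment_uniformly_continuous cF A0 e8.
pose s := Num.min (d / 2) 1.
have s0 : 0 < s by rewrite lt_min ltr01 divr_gt0.
have s1 : s <= 1 by rewrite ge_min lexx orbT.
have sd : s < d by rewrite gt_min; apply/orP; left; lra.
have wr0 : 0 < e * s / (4 * h) by rewrite divr_gt0 // mulr_gt0.
have [d' d'0 Hd'] := segment_uniformly_continuous cF A0 wr0.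
have rb0 : 0 < e * s / (8 * (M + 1)).
  by rewrite divr_gt0 ?mulr_gt0 //; lra.
pose d'' := Num.min d' (e * s / (8 * (M + 1))).
have d''0 : 0 < d'' by rewrite lt_min d'0.
pose N := (Num.truncn (h / d'')).+1; pose r := h / N%:R.
have N0 : 0 < N%:R :> R by rewrite ltr0n.
have r0 : 0 < r by rewrite divr_gt0.
have rd'' : r < d''.
  by rewrite /r ltr_pdivrMr // mulrC -ltr_pdivrMr // truncnS_gt.
have hN : h = N%:R * r by rewrite /r mulrC divfK // gt_eqF.
(* Raising the [i]-th weight by [s] shifts the argument by [s * x i], which lies between 0 and [s]
   on the cube. *)
pose w' j := if j == i then w j + s else w j.
have dotw' x : dot w' x = dot w x + s * x i.
  rewrite /dot /w' (bigD1 i) //= eqxx [in RHS](bigD1 i) //= mulrDl.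
  rewrite (eq_bigr (fun j => w j * x j)); first by ring.
  by move=> j /negPf ->.
exists (fun x => \sum_(j < N) (r / s) * (m x * F (dot w' x + (b + j%:R * r))
          + -1 * (m x * F (dot w x + (b + j%:R * r))))).
  apply: approximable_sum => j; apply: approximableZ; apply: approximableD => //.
  exact: approximableZ.
move=> x xc; have /andP[x0 x1] := xc i.
set y := dot w x + b; pose u := s * x i.
have yY : `|y| <= Y by apply: le_trans (ler_normD _ _) _; rewrite lerD2r norm_dot_le.
have := @riemann_shift_estimate R F A M s r (e * s / (4 * h)) (e / 8) h y u N r0 hN.
have -> : 0 <= u <= s by rewrite mulr_ge0 ?(ltW s0) // ler_piMr ?(ltW s0).
move=> /(_ isT) H; have {H} := H _ HM.
have -> : `|y| + h + s <= A by rewrite /A; lra.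
move=> /(_ isT) H; have {H} H := H _ _.
have {H} : `|r * (\sum_(j < N) F (y + u + j%:R * r) - \sum_(j < N) F (y + j%:R * r))
    - u * fdiff h F y| <= h * (e * s / (4 * h)) + 2 * s * (e / 8) + 2 * M * r.
  apply: H.
  - move=> a a' aA aA' aa'; apply/ltW/Hd' => //; apply: le_lt_trans aa' _.
    by apply: lt_le_trans rd'' _; rewrite ge_min lexx.
  - by move=> a a' aA aA' aa'; apply/ltW/Hd => //; exact: le_lt_trans sd.
set T1 := \sum_(j < N) _; set T2 := \sum_(j < N) _ => H.
have Mr : 2 * M * r <= e * s / 4.
  have : r * (8 * (M + 1)) <= e * s.
    rewrite -ler_pdivlMr; last by lra.
    by apply/ltW/(lt_le_trans rd''); rewrite ge_min lexx orbT.
  by move: (mulr_ge0 M0 (ltW r0)); nra.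
rewrite -mulr_sumr.
have -> : \sum_(j < N) (m x * F (dot w' x + (b + j%:R * r))
    + -1 * (m x * F (dot w x + (b + j%:R * r)))) = m x * (T1 - T2).
  rewrite -sumrB mulr_sumr; apply: eq_bigr => j _.
  rewrite dotw' (_ : dot w x + s * x i + (b + j%:R * r) = y + u + j%:R * r);
    last by rewrite /y /u; ring.
  rewrite (_ : dot w x + (b + j%:R * r) = y + j%:R * r); last by rewrite /y; ring.
  by ring.
rewrite (_ : _ - _ = - (m x / s * (r * (T1 - T2) - u * fdiff h F y))); last first.
  by rewrite /u; field; rewrite gt_eqF.
rewrite normrN !normrM normfV (gtr0_norm s0).
apply: le_trans (ler_wpM2l _ H) _; first by rewrite divr_ge0 // ltW.
rewrite mulrAC ler_pdivrMr //.
have hh : h * (e * s / (4 * h)) = e * s / 4 by field; rewrite gt_eqF.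
rewrite hh.
have es : 0 <= e * s by rewrite mulr_ge0 // ltW.
apply: le_trans (_ : 1 * (e * s / 4 + 2 * s * (e / 8) + 2 * M * r) <= _).
  apply: ler_wpM2r (m1 _ xc); rewrite addr_ge0 // ?addr_ge0 //.
  - by rewrite divr_ge0.
  - by rewrite !mulr_ge0 // ltW.
  - by rewrite !mulr_ge0 // ltW.
by rewrite mul1r; lra.
Qed.

Lemma fdiff_continuous h (F : R -> R) : continuous F -> continuous (fdiff h F).
Proof.
move=> cF y; rewrite /fdiff; apply: (@cvgB _ _ _ _ _ (fun y => F (y + h)) F); last exact: cF.
apply: (@continuous_comp _ _ _ (fun y => y + h) F); last exact: cF.
by apply: cvgD; [exact: cvg_id | exact: cvg_cst].
Qed.

Definition monomial (l : seq 'I_k) x : R := \prod_(i <- l) x i.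

Lemma monomial_le1 l x : in_cube x -> `|monomial l x| <= 1.
Proof.
move=> xc; rewrite /monomial; elim: l => [|i l IH].
  by rewrite big_nil normr1.
have /andP[x0 x1] := xc i; rewrite big_cons normrM (ger0_norm x0).
exact: mulr_ile1.
Qed.

Hypotheses (sigma_cont : continuous sigma) (sigma_npoly : ~ is_poly_fun sigma).

Lemma approximable_monomial_fdiff h l : 0 < h -> forall w b,
  approximable (fun x => monomial l x * iter (size l) (fdiff h) sigma (dot w x + b)).
Proof.
move=> h0; elim: l => [|i l IH] w b.
  apply: approximable_ext (approximable_unit w b) => x _.
  by rewrite /monomial big_nil mul1r.
have cI j : continuous (iter j (fdiff h) sigma).
  by elim: j => //= j; exact: fdiff_continuous.
apply: approximable_ext (approximable_fdiff i (cI _) h0 (@monomial_le1 l) IH w b).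
by move=> x _; rewrite /monomial big_cons /=; congr (_ * _); rewrite mulrC.
Qed.

(** Since [sigma] is not a polynomial, some iterated difference is nonzero at some [b]. Zero input
    weights turn that factor into a constant, which is divided out. *)
Lemma approximable_monomial l : approximable (monomial l).
Proof.
have [h [b [h0 hb]]] : exists h b, 0 < h /\ iter (size l) (fdiff h) sigma b != 0.
  apply: contrapT => nex; apply: sigma_npoly.
  apply: (@iter_fdiff_eq0_poly _ (size l)) => // h b h0.
  by apply/eqP; apply: contrapT => /negP nb; apply: nex; exists h, b.
have := approximable_monomial_fdiff l h0 (fun=> 0) b.
move=> /(@approximableZ (iter (size l) (fdiff h) sigma b)^-1).
apply: approximable_ext => x _.
have -> : dot (fun=> 0) x = 0 by rewrite /dot big1 // => j _; rewrite mul0r.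
by rewrite add0r mulrC mulfK.
Qed.

(** Quantifying over every monomial prefix [l] absorbs the factors [x i] and [1 - x i] of the
    recursion, so no Bernstein polynomial has to be expanded. *)
Lemma approximable_bernstein (p : ('I_k -> R) -> R) :
  (forall l, approximable (fun x => monomial l x * p x)) -> forall n j i l,
  approximable (fun x => monomial l x * (bernstein n j (x i) * p x)).
Proof.
move=> Hp; elim=> [|n IH] j i l /=.
  by apply: approximable_ext (approximableZ (j == 0%N)%:R (Hp l)) => x _; ring.
have H1 := approximableD (IH j i l) (approximableZ (-1) (IH j i (i :: l))).
case: j H1 => [|j] H1.
  by apply: approximable_ext H1 => x _; rewrite /monomial big_cons; ring.
apply: approximable_ext (approximableD (IH j i (i :: l)) H1) => x _.
by rewrite /monomial big_cons; ring.
Qed.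

Lemma approximable_mbernstein n (nu : {ffun 'I_k -> 'I_n.+1}) :
  approximable (mbernstein nu).
Proof.
have H (r : seq 'I_k) l :
    approximable (fun x => monomial l x * \prod_(i <- r) bernstein n (nu i) (x i)).
  elim: r l => [|i r IH] l.
    by apply: approximable_ext (approximable_monomial l) => x _; rewrite big_nil mulr1.
  by apply: approximable_ext (approximable_bernstein IH n (nu i) i l) => x _; rewrite big_cons.
apply: approximable_ext (H (index_enum 'I_k) [::]) => x _.
by rewrite /monomial big_nil mul1r.
Qed.

Theorem universal_approximation g : cube_continuous g -> approximable g.
Proof.
move=> cg; apply: approximable_limit => e e0.
have [n Hn] := mbernstein_dense cg e0; eexists; last exact: Hn.
apply: approximable_sum => nu; apply: approximableZ; exact: approximable_mbernstein.
Qed.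

(** All heights of a spline read from the same encoder. The hidden layers of the separate networks
    are concatenated, and each target gives weight 0 to the units of the others. *)
Lemma shared_hidden_layer (I : eqType) (r : seq I) (G : I -> ('I_k -> R) -> R) (e : R) :
  (forall i, i \in r -> approximable (G i)) -> 0 < e ->
  exists (m : nat) (W : 'I_m -> 'I_k -> R) (b : 'I_m -> R), forall i, i \in r ->
  exists a : 'I_m -> R, forall x, in_cube x ->
    `|G i x - \sum_(j < m) a j * sigma (\sum_(l < k) W j l * x l + b j)| <= e.
Proof.
move=> HG e0; elim: r HG => [|i r IH] HG.
  by exists 0%N, (fun _ _ => 0), (fun=> 0).
have [m1 [W1 [b1 H1]]] := IH (fun i' ir => HG i' (mem_behead (s := i :: r) ir)).
have [s Hs] := HG i (mem_head i r) e e0.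
pose m0 := size s; pose u (j : 'I_m0) := tnth (in_tuple s) j.
exists (m0 + m1)%N,
  (fun j => match fintype.split j with inl j0 => (u j0).1.2 | inr j1 => W1 j1 end),
  (fun j => match fintype.split j with inl j0 => (u j0).2 | inr j1 => b1 j1 end).
have sl (j : 'I_m0) : fintype.split (lshift m1 j) = inl j := unsplitK (inl j).
have sr (j : 'I_m1) : fintype.split (rshift m0 j) = inr j := unsplitK (inr j).
move=> i'; rewrite inE; have [-> _|_ /= i'r] := eqVneq i' i.
  exists (fun j => match fintype.split j with inl j0 => (u j0).1.1 | inr _ => 0 end) => x xc.
  rewrite big_split_ord /= [X in _ - (_ + X)]big1 ?addr0; last by move=> j _; rewrite sr mul0r.
  under eq_bigr do rewrite sl.
  by have H := Hs x xc; rewrite /shallow_net big_tnth in H; exact: H.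
have [a Ha] := H1 i' i'r.
exists (fun j => match fintype.split j with inl _ => 0 | inr j1 => a j1 end) => x xc.
rewrite big_split_ord /= [X in _ - (X + _)]big1 ?add0r; last by move=> j _; rewrite sl mul0r.
by under eq_bigr do rewrite sr; exact: Ha.
Qed.

End UniversalApproximation.

(** * Softplus and its inverse *)

Section Softplus.
Variable R : realType.

(** For [b <= a], [1 + expR a <= expR (a - b) * (1 + expR b)]; take logarithms. Errors in a
    pre-activation thus do not grow. *)
Lemma softplus_lipschitz (a b : R) : `|softplus a - softplus b| <= `|a - b|.
Proof.
wlog ba : a b / b <= a.
  move=> H; case: (leP b a) => [|/ltW] h; first exact: H.
  by rewrite distrC [`|a - b|]distrC; exact: H.
have pos (c : R) : 0 < 1 + expR c by rewrite addr_gt0 // expR_gt0.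
have mono : softplus b <= softplus a.
  by rewrite /softplus ler_ln ?posrE // lerD2l ler_expR.
have up : softplus a <= (a - b) + softplus b.
  rewrite /softplus -[a - b]expRK -lnM ?posrE ?expR_gt0 //.
  rewrite ler_ln ?posrE ?mulr_gt0 ?expR_gt0 // mulrDr mulr1 -expRD subrK lerD2r.
  by apply: le_trans (expR_ge1Dx _); lra.
by rewrite !ger0_norm; lra.
Qed.

Definition softplus_inv (v : R) : R := ln (expR v - 1).

Lemma softplus_invK (v : R) : 0 < v -> softplus (softplus_inv v) = v.
Proof.
move=> v0; have e1 : 1 < expR v by rewrite expR_gt1.
by rewrite /softplus /softplus_inv lnK ?posrE ?subr_gt0 // addrC subrK expRK.
Qed.

Lemma softplus_inv_continuous (v : R) : 0 < v -> {for v, continuous softplus_inv}.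
Proof.
move=> v0; apply: (@continuous_comp _ _ _ (fun v => expR v - 1) (@ln R)).
  by apply: cvgB; [exact: continuous_expR | exact: cvg_cst].
by apply: continuous_ln; rewrite subr_gt0 expR_gt1.
Qed.

Lemma cube_continuous_comp k (g : ('I_k -> R) -> R) (phi : R -> R) :
  cube_continuous g -> (forall x, in_cube x -> {for g x, continuous phi}) ->
  cube_continuous (fun x => phi (g x)).
Proof.
move=> cg cphi x xc e e0.
have /cvgrPdist_lt /(_ e e0) /nbhs_ballP [d /= d0 Hd] := cphi x xc.
have [d' d'0 Hd'] := cg x xc d d0; exists d' => // x' xc' xx'.
by rewrite distrC; apply: Hd; rewrite /ball /= distrC; exact: Hd'.
Qed.

End Softplus.

(** * Joint continuity in the input and the response *)

Section ContinuityOnProduct.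
Variables (R : realType) (k : nat) (f : ('I_k -> R) -> R -> R).
Hypothesis cf : cont_on_cube f.

Lemma cont_on_cube_slice y : in_unit y -> cube_continuous (fun x => f x y).
Proof.
move=> yc x xc e e0; have [d d0 Hd] := cf xc yc e0; exists d => // x' xc' xx'.
by apply: Hd => //; rewrite subrr normr0.
Qed.

Lemma cont_on_cube_uniform e : 0 < e -> exists2 delta : R, 0 < delta &
  forall x y y', in_cube x -> in_unit y -> in_unit y' -> `|y' - y| < delta ->
    `|f x y' - f x y| < e.
Proof.
move=> e0.
(* The pair of [x] and [y] becomes one point of a cube of dimension [k.+1], with [y] as coordinate
   [ord0]. *)
pose g (z : 'I_k.+1 -> R) := f (fun i => z (lift ord0 i)) (z ord0).
have cg : cube_continuous g.
  move=> z zc e' e'0.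
  have [d d0 Hd] := cf (fun i => zc (lift ord0 i)) (zc ord0) e'0.
  by exists d => // z' zc' zz'; apply: Hd => // i; exact: zc'.
have [d d0 Hd] := cube_uniformly_continuous cg e0; exists d => // x y y' xc yc yc' yy'.
pose z t (i : 'I_k.+1) := oapp x t (unlift ord0 i).
have gz t : g (z t) = f x t.
  rewrite /g /z unlift_none /=; congr (f _ _); apply/funext => i.
  by rewrite liftK.
rewrite -!gz; apply: Hd => i; rewrite /z; case: unliftP => [j|] _ //=; try exact: xc.
by rewrite subrr normr0.
Qed.

End ContinuityOnProduct.

(** * Partition of unity by the Lagrange basis *)

Section Lagrange.
Variable R : realType.

(** Both sides are polynomials of degree at most [n] that agree at the [n.+1] distinct nodes. *)
Lemma lagrange_sum1 n (a : 'I_n.+1 -> R) (y : R) : injective a ->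
  \sum_(j < n.+1) \prod_(k < n.+1 | k != j) ((y - a k) / (a j - a k)) = 1.
Proof.
move=> ia.
pose q j := \prod_(k < n.+1 | k != j) ((a j - a k)^-1 *: ('X - (a k)%:P)).
have qE j t : (q j).[t] = \prod_(k < n.+1 | k != j) ((t - a k) / (a j - a k)).
  by rewrite horner_prod; apply: eq_bigr => k _; rewrite hornerZ hornerXsubC mulrC.
have P0 : \sum_j q j - 1 = 0.
  apply: (@roots_geq_poly_eq0 _ _ [seq a i | i <- enum 'I_n.+1]).
  - apply/allP => _ /mapP[i _ ->]; rewrite rootE hornerD hornerN hornerC horner_sum.
    rewrite (bigD1 i) //= [X in _ + X - _]big1 => [|j ji].
      rewrite addr0 qE big1 ?subrr // => k ki; rewrite divff // subr_eq0.
      by apply: contra ki => /eqP /ia ->.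
    by rewrite qE (bigD1 i) 1?eq_sym //= subrr !mul0r.
  - by rewrite map_inj_uniq ?enum_uniq.
  - rewrite size_map size_enum_ord; apply: leq_trans (size_polyD _ _) _.
    rewrite size_polyN size_poly1 geq_max andbT; apply: leq_trans (size_sum _ _ _) _.
    apply/bigmax_leqP => j _; apply: leq_trans (size_prod_leq _ _) _.
    have cn : #|[pred k : 'I_n.+1 | k != j]| = n by rewrite cardC1 card_ord.
    rewrite cn leq_subLR; apply: leq_ltn_trans (_ : _ <= \sum_(k < n.+1 | k != j) 2)%N _.
      by apply: leq_sum => k _; apply: leq_trans (size_scale_leq _ _) _; rewrite size_XsubC.
    by rewrite sum_nat_const cn; lia.
under eq_bigr do rewrite -qE.
rewrite -horner_sum; apply/eqP; rewrite -subr_eq0; apply/eqP.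
by have := congr1 (horner^~ y) P0; rewrite hornerD hornerN hornerC horner0.
Qed.

End Lagrange.

(** * Spline pieces and uniform knots *)

Lemma count_leq_iota t q : count (fun i => i <= t)%N (iota 1 q) = minn t q.
Proof.
elim: q => [|q IH]; first by rewrite minn0.
rewrite -(addn1 q) iotaD count_cat IH /= addn0 add1n addn1.
by case: (leqP q.+1 t) => h /=; lia.
Qed.

Section Spice.
Variables (R : realType) (din m pp : nat) (sigma : R -> R) (K n : nat).
Variables (N : spice_params R din m pp) (x : 'I_din -> R).

Local Notation tk := (knot sigma K N x).

(** As the basis sums to 1, only the deviations of the heights from [v] are interpolated. In each
    basis function every one of the [n] factors has numerator at most the piece width [w] and
    denominator at least [w / n], hence is at most [n]. *)
Lemma piece_error i (y v e : R) : (0 < n)%N -> tk i < tk i.+1 ->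
  tk i <= y <= tk i.+1 ->
  (forall j, (j <= n)%N -> `|height sigma n N x i j - v| <= e) ->
  `|piece sigma K n N x i y - v| <= n.+1%:R * n%:R ^+ n * e.
Proof.
move=> n0 lt_t /andP[y0 y1] He.
have nR : 0 < n%:R :> R by rewrite ltr0n.
pose w := tk i.+1 - tk i; have w0 : 0 < w by rewrite subr_gt0.
pose a (k : 'I_n.+1) := node sigma K n N x i k.
have aB j k : a j - a k = (j%:R - k%:R) * w / n%:R.
  by rewrite /a /node -/w; field; rewrite gt_eqF.
have sep (j k : 'I_n.+1) : k != j -> w / n%:R <= `|a j - a k|.
  move=> kj; rewrite aB !normrM normfV (gtr0_norm w0) (gtr0_norm nR).
  rewrite -mulrA ler_peMl ?divr_ge0 ?(ltW w0) ?(ltW nR) //.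
  move: kj; rewrite -val_eqE neq_ltn => /orP[] h.
    have : k%:R + 1 <= j%:R :> R by rewrite natr1 ler_nat.
    by rewrite ler_normr => h'; apply/orP; left; lra.
  have : j%:R + 1 <= k%:R :> R by rewrite natr1 ler_nat.
  by rewrite ler_normr => h'; apply/orP; right; lra.
have ia : injective a.
  move=> j k ajk; apply/eqP; apply: contraT => /sep; rewrite ajk subrr normr0.
  by rewrite leNgt divr_gt0.
rewrite -[v]mulr1 -[X in v * X](lagrange_sum1 y ia) mulr_sumr /piece -sumrB.
apply: le_trans (ler_norm_sum _ _ _) _.
rewrite -mulrA -[X in X%:R * (_ * e)]card_ord mulr_natl -sumr_const; apply: ler_sum => j _.
rewrite -mulrBl normrM mulrC; apply: ler_pM => //; last by apply: He; rewrite -ltnS.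
have cn : #|[pred k : 'I_n.+1 | k != j]| = n by rewrite cardC1 card_ord.
rewrite normr_prod -[X in _ <= _ ^+ X]cn -prodr_const; apply: ler_prod => k kj.
rewrite normr_ge0 /= normrM normfV.
have := sep _ _ kj; have : `|y - a k| <= w.
  have : 0 <= k%:R * w / n%:R by rewrite divr_ge0 ?mulr_ge0 // ltW.
  have : k%:R * w / n%:R <= w.
    by rewrite ler_pdivrMr // mulrC ler_wpM2l ?(ltW w0) // ler_nat -ltnS.
  have wE : w = tk i.+1 - tk i by [].
  rewrite /a /node -/w; set z := k%:R * w / n%:R => z1 z0.
  by rewrite ler_norml; apply/andP; split; lra.
move=> h1 h2; have h3 : 0 < `|a j - a k| by apply: lt_le_trans h2; rewrite divr_gt0.
rewrite ler_pdivrMr //; apply: le_trans h1 _.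
by rewrite mulrC -ler_pdivrMr.
Qed.

(** Only the interior knots 1 to [P - 1] are counted, so the index is the minimum of [P - 1] and the
    integer part of [y * P]; the minimum matters at [y = 1]. *)
Lemma piece_index_uniform P (y : R) : K = P.+1 -> (0 < P)%N ->
  (forall i, tk i = i%:R / P%:R) -> in_unit y ->
  let l := piece_index sigma K N x y in
  (l < P)%N /\ l%:R / P%:R <= y <= l.+1%:R / P%:R.
Proof.
move=> -> P0 tkE /andP[y0 y1].
have PR : 0 < P%:R :> R by rewrite ltr0n.
have yP : 0 <= y * P%:R by rewrite mulr_ge0 // ltW.
rewrite /piece_index (eq_count (a2 := fun i => (i <= Num.truncn (y * P%:R))%N)); last first.
  by move=> i; rewrite tkE truncn_ge_nat // ler_pdivrMr.
rewrite count_leq_iota /=; set t := Num.truncn _.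
have /andP[t1 t2] : t%:R <= y * P%:R < t.+1%:R := truncn_itv yP.
split; first by lia.
rewrite ler_pdivrMr // ler_pdivlMr //; case: (leqP t (P.+1 - 2)) => h.
  by rewrite t1 ltW.
apply/andP; split.
  by apply: le_trans t1; rewrite ler_nat; lia.
by rewrite (_ : _.+1 = P); [rewrite ler_piMl // ltW | lia].
Qed.

Lemma knot_uniform i : (forall j, width_logit sigma N x j = 0) ->
  tk i = i%:R / K.-1%:R.
Proof.
move=> w0; rewrite /knot /width; rewrite (eq_bigr (fun=> K.-1%:R^-1)) => [|j _].
  by rewrite sumr_const card_ord mulr_natl.
rewrite w0 (eq_bigr (fun=> 1)) => [|l _]; last by rewrite w0 expR0.
by rewrite expR0 sumr_const card_ord mul1r.
Qed.

End Spice.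

(** * Construction of the network and the final estimate *)

Theorem theorem1 (R : realType) (d n : nat) (sigma : R -> R)
  (f : ('I_d.-1 -> R) -> R -> R) :
  (1 < d)%N -> (1 <= n)%N ->
  continuous sigma -> ~ is_poly_fun sigma ->
  cont_on_cube f ->
  (forall x y, in_cube x -> in_unit y -> 0 <= f x y) ->
  forall eps : R, 0 < eps ->
  exists (K m pp : nat) (N : spice_params R d.-1 m pp),
    (2 <= K)%N /\
    exists2 c : R, c < eps &
      forall x y, in_cube x -> in_unit y ->
        `|f x y - spice_hat sigma K n N x y| <= c.
Proof.
move=> _ n0 csigma npoly cf f0 eps eps0.
have nR : 0 < n%:R :> R by rewrite ltr0n.
pose C : R := n.+1%:R * n%:R ^+ n.
have C0 : 0 < C by rewrite mulr_gt0 ?ltr0n // exprn_gt0.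
(* Heights will be within [3 * e] of [f x y], and interpolation multiplies this by at most [C],
   giving [3 * C * e < 4 * C * e = eps]. *)
pose e := eps / (4 * C); have e0 : 0 < e by rewrite divr_gt0 // mulr_gt0.
have [delta delta0 Hdelta] := cont_on_cube_uniform cf e0.
pose P := (Num.truncn delta^-1).+1.
have PR : 0 < P%:R :> R by rewrite ltr0n.
have Pdelta : P%:R^-1 < delta by rewrite invf_plt ?posrE // truncnS_gt.
pose nd (i j : nat) : R :=
  i%:R / P%:R + j%:R * (i.+1%:R / P%:R - i%:R / P%:R) / n%:R.
have ndE i j : nd i j = i%:R / P%:R + (j%:R / n%:R) / P%:R.
  by rewrite /nd -natr1; field; rewrite (gt_eqF nR) (gt_eqF PR).
have jn (j : nat) : (j <= n)%N -> 0 <= j%:R / n%:R :> R /\ j%:R / n%:R <= 1 :> R.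
  by move=> h; rewrite divr_ge0 // ler_pdivrMr // mul1r ler_nat.
have nd_itv i j : (j <= n)%N -> i%:R / P%:R <= nd i j <= i.+1%:R / P%:R.
  move=> /jn [h0 h1]; rewrite ndE -natr1 mulrDl lerDl lerD2l divr_ge0 ?(ltW PR) //=.
  by rewrite ler_wpM2r // invr_ge0 ltW.
have knot_unit i : (i <= P)%N -> in_unit (i%:R / P%:R : R).
  by move=> h; rewrite /in_unit divr_ge0 // ler_pdivrMr // mul1r ler_nat.
have nd_unit i j : (i < P)%N -> (j <= n)%N -> in_unit (nd i j).
  move=> iP /(nd_itv i) /andP[h1 h2].
  have /andP[h3 _] := knot_unit _ (ltnW iP); have /andP[_ h4] := knot_unit _ iP.
  by rewrite /in_unit (le_trans h3) // (le_trans h2).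
(* The index [(i, 0)] stands for knot [i]. As [f] may vanish, [e] is added before the softplus is
   inverted. *)
pose G (t : nat * nat) x := if t.2 == 0%N then softplus_inv (f x (t.1%:R / P%:R) + e)
  else f x (nd t.1 t.2).
(* Knots run up to [P] but pieces only up to [P - 1], which keeps all sampling points in the unit
   interval. In [r], [j] stops at [n - 1], since node [n] is the next knot. *)
pose good (t : nat * nat) := (t.1 <= P)%N && ((t.2 == 0%N) || (t.1 < P)%N).
pose r := [seq t <- [seq (i, j) | i <- iota 0 P.+1, j <- iota 0 n] | good t].
have HG t : t \in r -> approximable sigma (G t).
  case: t => i j; rewrite mem_filter => /andP[/andP[iP jP]].
  move=> /allpairsP [[i' j'] /= [_ + [_ jj']]]; rewrite -{}jj' mem_iota => jn'.
  rewrite /= in iP jP.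
  apply: universal_approximation => //; rewrite /G /=.
  case: eqP jP => [_ _|_ /= iP'].
    apply: (@cube_continuous_comp _ _ (fun x => f x (i%:R / P%:R))
              (fun v => softplus_inv (v + e))).
      exact/(cont_on_cube_slice cf)/knot_unit.
    move=> x xc; apply: (@continuous_comp _ _ _ (fun v => v + e) (@softplus_inv R)).
      by apply: cvgD; [exact: cvg_id | exact: cvg_cst].
    apply: softplus_inv_continuous; rewrite ltr_wpDl //; apply: f0 => //.
    exact: knot_unit.
  by apply/(cont_on_cube_slice cf)/nd_unit; lia.
have [m [W [b HW]]] := shared_hidden_layer HG e0.
have /choice[a Ha] : forall t, exists a : 'I_m -> R, t \in r -> forall x, in_cube x ->
    `|G t x - \sum_(j < m) a j * sigma (\sum_(l < d.-1) W j l * x l + b j)| <= e.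
  move=> t; case: (boolP (t \in r)) => [/HW[a Ha]|_]; first by exists a.
  by exists (fun=> 0).
(* The second encoder layer is the identity, so the features are the hidden activations themselves.
   Zero width logits give equally spaced knots. *)
pose N := SpiceParams W b (fun k j => (k == j)%:R) (fun=> 0) (fun _ _ => 0) (fun=> 0)
  (fun i => a (i, 0%N)) (fun=> 0) (fun i j => a (i, j)) (fun _ _ => 0).
exists P.+1, m, m, N; split=> //.
exists (C * (3 * e)).
  have -> : eps = C * (4 * e) by rewrite /e; field; rewrite gt_eqF.
  by rewrite ltr_pM2l //; lra.
move=> x y xc yc.
have encE k : encode sigma N x k = sigma (\sum_(l < d.-1) W k l * x l + b k).
  rewrite /encode /= addr0 (bigD1 k) //= eqxx mul1r [X in _ + X = _]big1 ?addr0 // => j jk.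
  by rewrite eq_sym (negPf jk) mul0r.
have tE i : knot sigma P.+1 N x i = i%:R / P%:R.
  apply: knot_uniform => j; rewrite /width_logit /= addr0 big1 // => k _.
  by rewrite mul0r.
have [lP ly] := @piece_index_uniform _ _ _ _ sigma P.+1 N x P y erefl isT tE yc.
rewrite /spice_hat; set l := piece_index _ _ _ _ _ in lP ly *.
have /andP[ly1 ly2] := ly.
have r0 i : (i <= P)%N -> (i, 0%N) \in r.
  move=> iP; rewrite mem_filter {1}/good [(_, _).1]/= iP; apply: allpairs_f => //.
    by rewrite mem_iota; lia.
  by rewrite mem_iota; lia.
have near t : l%:R / P%:R <= t <= l.+1%:R / P%:R -> in_unit t -> `|f x t - f x y| <= e.
  move=> /andP[t1 t2] tu; apply: le_trans (ltW (Hdelta x y t xc yc tu _)) _ => //.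
  apply: le_lt_trans Pdelta; move: ly2 t2; rewrite -natr1 mulrDl mul1r => ly2 t2.
  by rewrite ler_norml; apply/andP; split; lra.
(* One [e] is the network error passed through the softplus, the other is the shift built into
   [G]. *)
have kh i : (i <= P)%N -> `|knot_height sigma N x i - f x (i%:R / P%:R)| <= 2 * e.
  move=> iP; have fi : 0 <= f x (i%:R / P%:R) by apply: f0 => //; exact: knot_unit.
  have := Ha _ (r0 _ iP) _ xc; rewrite /G /=.
  set S := \sum_(j < m) _; rewrite distrC => HS.
  have -> : knot_height sigma N x i = softplus S.
    rewrite /knot_height /= addr0; congr softplus.
    by apply: eq_bigr => k _; rewrite encE.
  have := le_trans (softplus_lipschitz _ _) HS.
  rewrite softplus_invK; last by rewrite ltr_wpDl.
  by rewrite !ler_norml => /andP[h1 h2]; apply/andP; split; lra.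
have Hh j : (j <= n)%N -> `|height sigma n N x l j - f x y| <= 3 * e.
  move=> jn'; rewrite /height; case: eqP => [_|/eqP j0].
    have := kh _ (ltnW lP); have : `|f x (l%:R / P%:R) - f x y| <= e.
      by apply: near; [rewrite lexx (le_trans ly1) | exact/knot_unit/ltnW].
    by rewrite !ler_norml => /andP[h1 h2] /andP[h3 h4]; apply/andP; split; lra.
  case: eqP => [_|/eqP jnn].
    have := kh _ lP; have : `|f x (l.+1%:R / P%:R) - f x y| <= e.
      by apply: near; [rewrite lexx (le_trans ly1) | exact/knot_unit].
    by rewrite !ler_norml => /andP[h1 h2] /andP[h3 h4]; apply/andP; split; lra.
  have rj : (l, j) \in r.
    rewrite mem_filter {1}/good [(_, _).1]/= lP (ltnW lP) orbT; apply: allpairs_f => //.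
      by rewrite mem_iota; lia.
    by rewrite mem_iota; lia.
  have := Ha _ rj _ xc; rewrite /G /= (negPf j0).
  have -> : inter_height sigma N x l j =
      \sum_(j' < m) a (l, j) j' * sigma (\sum_(l' < d.-1) W j' l' * x l' + b j').
    rewrite /inter_height /= addr0.
    by apply: eq_bigr => k _; rewrite encE.
  have : `|f x (nd l j) - f x y| <= e.
    by apply: near; [exact: nd_itv | exact: nd_unit].
  by rewrite !ler_norml => /andP[h1 h2] /andP[h3 h4]; apply/andP; split; lra.
have := @piece_error _ _ _ _ sigma P.+1 n N x l y (f x y) (3 * e) n0.
rewrite !tE -/C => /(_ _ ly Hh).
have -> : l%:R / P%:R < l.+1%:R / P%:R :> R by rewrite ltr_pM2r ?invr_gt0 // ltr_nat.
move=> /(_ isT) => Hp; apply: le_trans Hp; rewrite distrC.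
(* Clipping at 0 cannot increase the distance to the nonnegative value [f x y]. *)
have := f0 x y xc yc; set p := piece _ _ _ _ _ _ _; set v := f x y => v0.
rewrite maxEle; case: (leP p 0) => // p0.
by rewrite sub0r normrN (ger0_norm v0) distrC ger0_norm; lra.
Qed.
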